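(* The Poisson manifolds $(W_3,e_3)$, $(W_3,e_4)$, $(W_3,e_5)$, $(W_3,e_{10})$ and $(W_3,e_{11})$, where $W_3=\mathrm{Tot}(\mathcal O_{\mathbb P^1}(-3)\oplus\mathcal O_{\mathbb P^1}(1))$ and the $e_i$ are the Poisson structures specified in the context, are pairwise nonisomorphic.
   Context: $W_3$ is obtained by gluing $U=\mathbb C^3_{\{z,u_1,u_2\}}$ and $V=\mathbb C^3_{\{\xi,v_1,v_2\}}$ by $(\xi,v_1,v_2)=(z^{-1},z^3u_1,z^{-1}u_2)$ where $z,\xi\neq0$. Write $\partial_0=\partial/\partial z$, $\partial_2=\partial/\partial u_2$. The global holomorphic Poisson structures on $W_3$ are given on $U$ by $$e_3=\partial_2\wedge\partial_0,\quad e_4=z\,\partial_2\wedge\partial_0,\quad e_5=z^2\,\partial_2\wedge\partial_0,\quad e_{10}=u_2\,\partial_2\wedge\partial_0,\quad e_{11}=zu_2\,\partial_2\wedge\partial_0 .$$ Poisson manifolds $(W_3,\pi)$ and $(W_3,\pi')$ are isomorphic if there is a biholomorphism $\phi:W_3\to W_3$ with $\phi_*\pi=\pi'$. *)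

(* Defs.v *)
From HB Require Import structures.
From mathcomp Require Import all_boot all_order all_algebra.
From mathcomp Require Import generic_quotient complex ring.
From mathcomp Require Import all_classical all_reals all_analysis.

Set Implicit Arguments.
Unset Strict Implicit.
Unset Printing Implicit Defensive.
Import Order.TTheory GRing.Theory Num.Theory numFieldNormedType.Exports.
Local Open Scope classical_set_scope.
Local Open Scope ring_scope.
Local Open Scope quotient_scope.

(* Everything is set up over a field [K : numFieldType]; the complex case is
   [K := R[i]] with [R : realType], where [differentiable] on an open subset of
   'rV[K]_3 is holomorphy. *)

Section Row3.
Variable K : numFieldType.

Definition row3 (a b c : K) : 'rV[K]_3 := \row_(j < 3) [:: a; b; c]`_j.

(* Basis of the tangent space in either chart: d0 = d/dz (resp. d/dxi),
   d1 = d/du1 (resp. d/dv1), d2 = d/du2 (resp. d/dv2). *)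
Definition d0 : 'rV[K]_3 := row3 1 0 0.
Definition d1 : 'rV[K]_3 := row3 0 1 0.
Definition d2 : 'rV[K]_3 := row3 0 0 1.
Definition dd (l : 'I_3) : 'rV[K]_3 := delta_mx 0 l.

(* A bivector is encoded by its skew-symmetric 3 x 3 matrix. *)
Definition wedge (a b : 'rV[K]_3) : 'M[K]_3 := a^T *m b - b^T *m a.

(* The coordinates (z, u1, u2), resp. (xi, v1, v2), are the columns 0, 1, 2.
   The inverse change of coordinates is given by the same formula. *)
Definition trans (p : 'rV[K]_3) : 'rV[K]_3 :=
  row3 (p 0 0)^-1 (p 0 0 ^+ 3 * p 0 1) ((p 0 0)^-1 * p 0 2%:R).

Lemma row3_eqP (p q : 'rV[K]_3) :
  p 0 0 = q 0 0 -> p 0 1 = q 0 1 -> p 0 2%:R = q 0 2%:R -> p = q.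
Proof.
move=> h0 h1 h2; apply/rowP; case=> [[|[|[|//]]] hj].
- by rewrite (_ : Ordinal hj = 0) //; apply/val_inj.
- by rewrite (_ : Ordinal hj = 1) //; apply/val_inj.
- by rewrite (_ : Ordinal hj = 2%:R) //; apply/val_inj.
Qed.

Lemma row3E (a b c : K) :
  ((row3 a b c 0 0 = a) * (row3 a b c 0 1 = b) * (row3 a b c 0 2%:R = c))%type.
Proof. by rewrite !mxE. Qed.

Lemma transK (p : 'rV[K]_3) : p 0 0 != 0 -> trans (trans p) = p.
Proof.
move=> p0; apply: row3_eqP; rewrite /trans !row3E ?invrK //.
- by rewrite exprVn mulrA mulVf ?mul1r // expf_neq0.
- by rewrite mulrA mulfV ?mul1r.
Qed.

Lemma trans_neq0 (p : 'rV[K]_3) : (trans p 0 0 != 0) = (p 0 0 != 0).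
Proof. by rewrite /trans row3E invr_eq0. Qed.

End Row3.

Arguments d0 {K}.
Arguments d1 {K}.
Arguments d2 {K}.
Arguments dd {K}.

Notation chU := true (only parsing).
Notation chV := false (only parsing).

Section W3.
Variable K : numFieldType.

(* The disjoint union of the charts U (tag chU) and V (tag chV). *)
Definition charts := {c : bool & 'rV[K]_3}.

Definition glued (x y : charts) : bool :=
  if tag x == tag y then tagged x == tagged y
  else (tagged x 0 0 != 0) && (tagged y == trans (tagged x)).

Lemma glued_refl : reflexive glued.
Proof. by move=> x; rewrite /glued !eqxx. Qed.

Lemma glued_sym : symmetric glued.
Proof.
move=> [a p] [b q]; rewrite /glued /= [b == a]eq_sym.
case: ifP => _; first by rewrite eq_sym.
apply/andP/andP => -[h /eqP ->]; rewrite trans_neq0; split => //;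
  by rewrite transK.
Qed.

Lemma glued_trans : transitive glued.
Proof.
move=> [b q] [a p] [c r]; rewrite /glued /=.
case: (eqVneq a b) => [->|ab].
  by move=> /eqP ->.
move=> /andP[p0 /eqP ->].
case: (eqVneq b c) => [<-|bc].
  by rewrite (negbTE ab) => /eqP <-; rewrite p0 eqxx.
have -> : a = c by move: ab bc; case: a; case: b; case: c.
by rewrite eqxx => /andP[_ /eqP ->]; rewrite transK.
Qed.

Canonical glued_equiv := EquivRel glued glued_refl glued_sym glued_trans.

Definition W3 : topologicalType := quotient_topology {eq_quot glued_equiv}.

(* Inverse of the chart [c]. *)
Definition emb (c : bool) (p : 'rV[K]_3) : W3 :=
  \pi_({eq_quot glued_equiv}) (existT _ c p : charts).

(* The chart [c]; only meaningful on its domain [range (emb c)]. *)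
Definition coord (c : bool) (w : W3) : 'rV[K]_3 :=
  let x : charts := repr (w : {eq_quot glued_equiv}) in
  if tag x == c then tagged x else trans (tagged x).

Lemma embK (c : bool) : cancel (emb c) (coord c).
Proof.
move=> p; rewrite /coord /emb.
set x := repr _; have : glued (existT _ c p) x.
  by have /eqmodP := reprK (\pi_({eq_quot glued_equiv}) (existT _ c p : charts));
    rewrite glued_sym.
rewrite /glued /= [c == _]eq_sym; case: ifP => _ /=; first by move=> /eqP.
by move=> /andP[p0 /eqP ->]; rewrite transK.
Qed.

Lemma coordK (c : bool) (w : W3) : range (emb c) w -> emb c (coord c w) = w.
Proof. by move=> [p _ <-]; rewrite embK. Qed.

Lemma emb_trans (c : bool) (p : 'rV[K]_3) :
  p 0 0 != 0 -> emb (~~ c) (trans p) = emb c p.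
Proof.
move=> p0; apply/eqmodP; rewrite /= /glued /= trans_neq0 p0 transK //=.
by case: c; rewrite /= eqxx.
Qed.

Lemma emb_cover (w : W3) : exists c p, w = emb c p.
Proof.
exists (tag (repr (w : {eq_quot glued_equiv}))).
exists (tagged (repr (w : {eq_quot glued_equiv}))).
rewrite -[LHS](reprK (w : {eq_quot glued_equiv})) /emb.
by case: (repr _).
Qed.

(* By continuity, the expression of [phi] in charts is defined on an open set. *)
Definition holomorphic (phi : W3 -> W3) : Prop :=
  continuous phi /\
  forall (a b : bool) (p : 'rV[K]_3), range (emb b) (phi (emb a p)) ->
    differentiable (coord b \o phi \o emb a) p.

(* [bivec c] is the expression in the chart [c] of a global section of the
   second exterior power of the tangent bundle; [poisson_jacobi] is the Jacobi
   identity of the bracket {x_i, x_j} = bivec i j. *)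
Record poisson := Poisson {
  bivec :> bool -> 'rV[K]_3 -> 'M[K]_3;
  poisson_skew : forall c p, (bivec c p)^T = - bivec c p;
  poisson_holo : forall c p, differentiable (bivec c) p;
  poisson_glue : forall p : 'rV[K]_3, p 0 0 != 0 ->
    bivec chV (trans p) =
    (jacobian (@trans K) p)^T *m bivec chU p *m jacobian (@trans K) p;
  poisson_jacobi : forall c p (i j k : 'I_3),
    \sum_(l < 3)
      (bivec c p i l * 'D_(dd l) (fun q => bivec c q j k) p
     + bivec c p j l * 'D_(dd l) (fun q => bivec c q k i) p
     + bivec c p k l * 'D_(dd l) (fun q => bivec c q i j) p) = 0 }.

(* phi_* pi = pi'. [jacobian f p] acts on row vectors from the right, so J^T B J
   is the image of the bivector B under the differential. *)
Definition pushes (phi : W3 -> W3) (pi pi' : poisson) : Prop :=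
  forall (a b : bool) (p : 'rV[K]_3), range (emb b) (phi (emb a p)) ->
    let f := coord b \o phi \o emb a in
    pi' b (f p) = (jacobian f p)^T *m pi a p *m jacobian f p.

Definition poisson_isomorphic (pi pi' : poisson) : Prop :=
  exists phi psi : W3 -> W3,
    [/\ cancel phi psi, cancel psi phi, holomorphic phi, holomorphic psi
      & pushes phi pi pi'].

End W3.

Section Monomial.
Variable K : numFieldType.

(* The bivector z^a u2^b d2 /\ d0 in both charts. In the coordinates of V,
   d/du2 = xi d2 and d/dz = - xi^2 d0 + 3 xi v1 d1 - xi v2 d2, hence
   d/du2 /\ d/dz = xi^2 d2 /\ (- xi d0 + 3 v1 d1),
   while z^a u2^b = xi^(- a - b) v2^b. *)
Definition mono_bivec (a b : nat) (c : bool) (p : 'rV[K]_3) : 'M[K]_3 :=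
  if c then (p 0 0 ^+ a * p 0 2%:R ^+ b) *: wedge d2 d0
  else (p 0 0 ^+ (2 - (a + b)) * p 0 2%:R ^+ b) *:
         wedge d2 (- p 0 0 *: d0 + (3%:R * p 0 1) *: d1).


Lemma row3S (a b c : K) :
  row3 a b c = a *: dd 0 + b *: dd 1 + c *: dd 2%:R.
Proof.
by apply: row3_eqP; rewrite row3E !mxE /= ?mulr1 ?mulr0 ?addr0 ?add0r.
Qed.

Lemma diff_coord3 (p v : 'rV[K]_3) (j : 'I_3) :
  'd (fun q : 'rV[K]_3 => q 0 j : K) p v = v 0 j.
Proof.
have @f : {linear 'rV[K]_3 -> K}.
  by exists (fun q : 'rV[K]_3 => q 0 j); do 2![eexists]; do ?[constructor];
    rewrite ?mxE// => ? *; rewrite ?mxE//; move=> ?; rewrite !mxE.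
by rewrite (_ : (fun _ => _) = f) // diff_lin //; exact: coord_continuous.
Qed.

Lemma is_derive_coord3 (p v : 'rV[K]_3) (j : 'I_3) :
  is_derive p v (fun q : 'rV[K]_3 => q 0 j : K) (v 0 j).
Proof.
have df : differentiable (fun q : 'rV[K]_3 => q 0 j : K) p.
  exact: differentiable_coord.
apply: DeriveDef; first exact: diff_derivable.
by rewrite deriveE // diff_coord3.
Qed.

Lemma mul_jacobian3E (f : 'rV[K]_3 -> 'rV[K]_3) (p v : 'rV[K]_3) (j : 'I_3) :
  differentiable f p ->
  (v *m jacobian f p) 0 j = 'D_v (fun q => f q 0 j : K) p.
Proof.
move=> df; rewrite mul_rV_lin1.
have dc := @differentiable_coord K 1 3 (f p) 0 j.
rewrite deriveE; last exact: (differentiable_comp df dc).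
by rewrite (diff_comp df dc) /= diff_coord3.
Qed.

Lemma differentiable_monom (p : 'rV[K]_3) (i j : 'I_3) m n :
  differentiable (fun q : 'rV[K]_3 => q 0 i ^+ m * q 0 j ^+ n : K) p.
Proof.
have dX (k : 'I_3) l : differentiable (fun q : 'rV[K]_3 => q 0 k ^+ l : K) p.
  case: l => [|l]; first exact: differentiable_cst.
  have := differentiableX l (@differentiable_coord K 1 3 p 0 k).
  by rewrite exprfctE.
exact: (differentiableM (dX i m) (dX j n)).
Qed.

Lemma differentiable_trans (p : 'rV[K]_3) :
  p 0 0 != 0 -> differentiable (@trans K) p.
Proof.
move=> p0.
have dc j : differentiable (fun q : 'rV[K]_3 => q 0 j : K) p.
  exact: differentiable_coord.
have dV : differentiable (fun q : 'rV[K]_3 => (q 0 0)^-1 : K) p.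
  exact: (differentiableV (dc 0) p0).
rewrite (_ : @trans K = fun q => (q 0 0)^-1 *: dd 0
    + (q 0 0 ^+ 3 * q 0 1 ^+ 1) *: dd 1 + ((q 0 0)^-1 * q 0 2%:R) *: dd 2%:R);
  last by apply/funext => q; rewrite expr1 -row3S.
apply: differentiableD; first apply: differentiableD.
- exact: differentiableZl.
- exact/differentiableZl/differentiable_monom.
- exact/differentiableZl/(differentiableM dV (dc 2%:R)).
Qed.

Lemma mul_jacobian_trans (p v : 'rV[K]_3) : p 0 0 != 0 ->
  v *m jacobian (@trans K) p =
  row3 (- (p 0 0) ^- 2 * v 0 0)
       (3%:R * p 0 0 ^+ 2 * p 0 1 * v 0 0 + p 0 0 ^+ 3 * v 0 1)
       (- (p 0 0) ^- 2 * p 0 2%:R * v 0 0 + (p 0 0)^-1 * v 0 2%:R).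
Proof.
move=> p0.
have dc l := is_derive_coord3 p v l.
have dV : is_derive p v (fun q : 'rV[K]_3 => (q 0 0)^-1 : K)
    (- (p 0 0) ^- 2 *: v 0 0).
  apply: DeriveDef; first by apply: derivableV => //; exact: diff_derivable.
  by rewrite deriveV //; rewrite derive_val.
have dX : is_derive p v (fun q : 'rV[K]_3 => q 0 0 ^+ 3 : K)
    ((3%:R * p 0 0 ^+ 2) *: v 0 0).
  by have := is_deriveX 3 (dc 0); rewrite exprfctE.
have d01 := is_deriveM dX (dc 1); have d02 := is_deriveM dV (dc 2%:R).
have dtr := differentiable_trans p0.
apply: row3_eqP; rewrite mul_jacobian3E // row3E.
- rewrite (_ : (fun q => _) = fun q : 'rV[K]_3 => (q 0 0)^-1).
    by rewrite derive_val.
  by apply/funext => q; rewrite row3E.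
- rewrite (_ : (fun q => _) = (fun q : 'rV[K]_3 => q 0 0 ^+ 3 : K) * (fun q : 'rV[K]_3 => q 0 1 : K)).
    by rewrite derive_val /GRing.scale /=; ring.
  by apply/funext => q; rewrite row3E.
- rewrite (_ : (fun q => _) = (fun q : 'rV[K]_3 => (q 0 0)^-1 : K) * (fun q : 'rV[K]_3 => q 0 2%:R : K)).
    by rewrite derive_val /GRing.scale /=; ring.
  by apply/funext => q; rewrite row3E.
Qed.

Lemma sum3 (F : 'I_3 -> K) : \sum_(l < 3) F l = F 0 + F 1 + F 2%:R.
Proof.
rewrite !big_ord_recr big_ord0 /= add0r.
by congr (F _ + F _ + F _); apply/val_inj.
Qed.

Lemma wedge_mul (A : 'M[K]_3) (a b : 'rV[K]_3) :
  A^T *m wedge a b *m A = wedge (a *m A) (b *m A).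
Proof. by rewrite /wedge mulmxBr mulmxBl !trmx_mul !mulmxA. Qed.

Lemma wedgeE (a b : 'rV[K]_3) i j :
  wedge a b i j = a 0 i * b 0 j - b 0 i * a 0 j.
Proof. by rewrite !mxE !big_ord1 !mxE. Qed.

Variables a b : nat.
Hypothesis ab : (a + b <= 2)%N.

Lemma mono_skew c p : (mono_bivec a b c p)^T = - mono_bivec a b c p.
Proof.
by apply/matrixP => i j; case: c; rewrite !mxE -/(wedge _ _) !big_ord1 !mxE; ring.
Qed.

Lemma mono_glue (p : 'rV[K]_3) : p 0 0 != 0 ->
  mono_bivec a b chV (trans p) =
  (jacobian (@trans K) p)^T *m mono_bivec a b chU p *m jacobian (@trans K) p.
Proof.
move=> p0; rewrite /mono_bivec -scalemxAr -scalemxAl wedge_mul.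
rewrite !mul_jacobian_trans //.
have -> : (trans p 0 0 ^+ (2 - (a + b)) * trans p 0 2%:R ^+ b : K) =
    (p 0 0)^-1 ^+ 2 * (p 0 0 ^+ a * p 0 2%:R ^+ b).
  rewrite !row3E exprMn; set w := (p 0 0)^-1.
  have -> : w ^+ 2 = w ^+ (2 - (a + b)) * (w ^+ a * w ^+ b).
    by rewrite -!exprD subnK.
  have wa : w ^+ a * p 0 0 ^+ a = 1 by rewrite -exprMn mulVf ?expr1n.
  transitivity (w ^+ (2 - (a + b)) * (w ^+ b * p 0 2%:R ^+ b) *
                (w ^+ a * p 0 0 ^+ a)); last by ring.
  by rewrite wa mulr1.
rewrite [_^-1 ^+ 2 * _]mulrC -[LHS]scalerA; congr (_ *: _).
apply/matrixP => i j; rewrite [LHS]mxE !wedgeE.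
case: i => [[|[|[|//]]] hi]; case: j => [[|[|[|//]]] hj];
 rewrite /trans /d0 /d1 /d2 !mxE /= ?mxE /=; by field.
Qed.

Lemma mono_holo c (p : 'rV[K]_3) : differentiable (mono_bivec a b c) p.
Proof.
case: c; first exact/differentiableZl/differentiable_monom.
rewrite (_ : mono_bivec a b chV = fun q : 'rV[K]_3 =>
  (q 0 0 ^+ (2 - (a + b)) * q 0 2%:R ^+ b * (q 0 0 ^+ 1 * q 0 0 ^+ 0)) *:
     - wedge d2 d0
  + (q 0 0 ^+ (2 - (a + b)) * q 0 2%:R ^+ b * (q 0 1 ^+ 1 * q 0 0 ^+ 0)) *:
     (3%:R *: wedge d2 d1)); last first.
  apply/funext => q; rewrite /mono_bivec; apply/matrixP => i j.
  by rewrite !mxE !big_ord1 !mxE; ring.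
apply: differentiableD; apply: differentiableZl;
  exact: differentiableM (differentiable_monom _ _ _ _ _)
    (differentiable_monom _ _ _ _ _).
Qed.

Lemma mono_jacobi c (p : 'rV[K]_3) (i j k : 'I_3) :
  \sum_(l < 3)
    (mono_bivec a b c p i l * 'D_(dd l) (fun q => mono_bivec a b c q j k : K) p
   + mono_bivec a b c p j l * 'D_(dd l) (fun q => mono_bivec a b c q k i : K) p
   + mono_bivec a b c p k l * 'D_(dd l) (fun q => mono_bivec a b c q i j : K) p)
  = 0.
Proof.
have dc l j := is_derive_coord3 p (dd l) j.
have mono_derive n l : exists G : K, is_derive p (dd l)
    (fun q : 'rV[K]_3 => q 0 0 ^+ n * q 0 2%:R ^+ b : K) G.
  exists ('D_(dd l) (fun q : 'rV[K]_3 => q 0 0 ^+ n * q 0 2%:R ^+ b : K) p).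
  by apply/derivableP/diff_derivable/differentiable_monom.
case: c.
- have D l j' k' : 'D_(dd l) (fun q => mono_bivec a b chU q j' k' : K) p =
      'D_(dd l) (fun q : 'rV[K]_3 => q 0 0 ^+ a * q 0 2%:R ^+ b : K) p
      * wedge d2 d0 j' k'.
    have [G dG] := mono_derive a l.
    rewrite (_ : (fun q => mono_bivec _ _ _ q _ _) =
        (wedge d2 d0 j' k') \*: (fun q : 'rV[K]_3 => q 0 0 ^+ a * q 0 2%:R ^+ b : K)).
      by have dZ := is_deriveZ (wedge d2 d0 j' k') dG; rewrite !derive_val /GRing.scale /= mulrC.
    by apply/funext => q; rewrite mxE mulrC.
  rewrite sum3 !D.
  move: (derive _ _ _) (derive _ _ _) (derive _ _ _) => G0 G1 G2.
  have E j' k' : mono_bivec a b chU p j' k' =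
      (p 0 0 ^+ a * p 0 2%:R ^+ b) * wedge d2 d0 j' k' by rewrite [LHS]mxE.
  by rewrite !E; move: (_ * _ ^+ b) => g; rewrite !wedgeE;
    move: (d2 0 i) (d2 0 j) (d2 0 k) (d0 0 i) (d0 0 j) (d0 0 k);
    move: (d2 0 0) (d2 0 1) (d2 0 2%:R) (d0 0 0) (d0 0 1) (d0 0 2%:R) => *; ring.
- pose n := (2 - (a + b))%N.
  pose w (q : 'rV[K]_3) := wedge d2 (- q 0 0 *: d0 + (3%:R * q 0 1) *: d1).
  have D l j' k' : 'D_(dd l) (fun q => mono_bivec a b chV q j' k' : K) p =
      'D_(dd l) (fun q : 'rV[K]_3 => q 0 0 ^+ n * q 0 2%:R ^+ b : K) p * w p j' k'
      + (p 0 0 ^+ n * p 0 2%:R ^+ b) * w (dd l) j' k'.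
    have [G dG] := mono_derive n l.
    have dw : is_derive p (dd l) (fun q => w q j' k' : K) (w (dd l) j' k').
      have wE q : w q j' k' =
          q 0 0 * (- wedge d2 d0 j' k') + q 0 1 * (3%:R * wedge d2 d1 j' k').
        by rewrite /w !wedgeE !mxE; ring.
      rewrite wE (_ : (fun q => _) =
          (- wedge d2 d0 j' k') \*: (fun q : 'rV[K]_3 => q 0 0 : K)
          + (3%:R * wedge d2 d1 j' k') \*: (fun q : 'rV[K]_3 => q 0 1 : K)).
        apply: is_derive_eq.
        by rewrite /GRing.scale /= mulrC [X in _ + X]mulrC.
      by apply/funext => q; rewrite wE mulrC [X in _ + X]mulrC.
    have dM := is_deriveM dG dw.
    rewrite (_ : (fun q => mono_bivec _ _ _ q _ _) =
        (fun q : 'rV[K]_3 => q 0 0 ^+ n * q 0 2%:R ^+ b : K) *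
        (fun q => w q j' k')).
      by rewrite !derive_val /GRing.scale /=; ring.
    by apply/funext => q; rewrite [LHS]mxE.
  rewrite sum3 !D.
  move: (derive _ _ _) (derive _ _ _) (derive _ _ _) => G0 G1 G2.
  have E j' k' : mono_bivec a b chV p j' k' =
      (p 0 0 ^+ n * p 0 2%:R ^+ b) * w p j' k' by rewrite [LHS]mxE.
  rewrite !E; move: (_ * _ ^+ b) => g.
  have wE q j' k' : w q j' k' =
      d2 0 j' * (- q 0 0 * d0 0 k' + 3%:R * q 0 1 * d1 0 k')
      - (- q 0 0 * d0 0 j' + 3%:R * q 0 1 * d1 0 j') * d2 0 k'.
    by rewrite /w wedgeE !(mxE, row3S).
  clearbody w; rewrite !wE.
  have -> : dd 0 0 0 = 1 :> K by rewrite mxE.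
  have -> : dd 0 0 1 = 0 :> K by rewrite mxE.
  have -> : dd 1 0 0 = 0 :> K by rewrite mxE.
  have -> : dd 1 0 1 = 1 :> K by rewrite mxE.
  have -> : dd 2%:R 0 0 = 0 :> K by rewrite mxE.
  have -> : dd 2%:R 0 1 = 0 :> K by rewrite mxE.
  rewrite /d2 /d0 /d1 !row3E -/d0 -/d1 -/d2.
  move: (p 0 0) (p 0 1) (d2 0 i) (d2 0 j) (d2 0 k) (d0 0 i) (d0 0 j) (d0 0 k)
    (d1 0 i) (d1 0 j) (d1 0 k) => *; ring.
Qed.

Definition mono_poisson : poisson K :=
  Poisson mono_skew mono_holo mono_glue mono_jacobi.

End Monomial.

Section Generators.
Variable K : numFieldType.

(* d2 /\ d0, z d2 /\ d0, z^2 d2 /\ d0, u2 d2 /\ d0, z u2 d2 /\ d0 on U *)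
Definition e3 : poisson K := @mono_poisson K 0 0 isT.
Definition e4 : poisson K := @mono_poisson K 1 0 isT.
Definition e5 : poisson K := @mono_poisson K 2 0 isT.
Definition e10 : poisson K := @mono_poisson K 0 1 isT.
Definition e11 : poisson K := @mono_poisson K 1 1 isT.

End Generators.

(* Main.v *)
Require Import Defs.
From mathcomp Require Import all_boot all_order all_algebra complex.
From mathcomp Require Import reals.
From mathcomp Require Import generic_quotient.
From mathcomp Require Import all_classical all_analysis.

Set Implicit Arguments.
Unset Strict Implicit.
Unset Printing Implicit Defensive.
Import Order.TTheory GRing.Theory Num.Theory numFieldNormedType.Exports.
Local Open Scope classical_set_scope.
Local Open Scope ring_scope.

(** A Poisson isomorphism maps the zeros of one structure onto the zeros of
    the other, because the bivectors correspond under an invertible Jacobian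
    ([jacobian_inverse]). So whatever a biholomorphism preserves about the zero
    set as a subset of W3 is an invariant of the Poisson structure. Three such
    invariants separate the five structures. On U the structure
    z^a u2^b d2 /\ d0 vanishes where z = 0 (if a > 0) or u2 = 0 (if b > 0); on
    V it vanishes where xi = 0 (if a + b < 2), or v2 = 0 (if b > 0), or
    xi = v1 = 0. Hence its zero set is
<<
      e3  : the plane xi = 0;
      e4  : two disjoint planes;
      e5  : a plane and a line, disjoint;
      e10 : a plane and the surface u2 = 0, crossing along a line;
      e11 : the plane z = 0, the surface u2 = 0, and the line xi = v1 = 0,
            which meets that surface in one point.
>>
    Consider at each zero the velocities of the differentiable curves that stay
    in the zero set. A holomorphic map with invertible Jacobian carries them to
    velocities at the image point, so the maximal number of linearly
    independent ones is preserved ([isomorphic_tangent_rank]). Some zero admits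
    three exactly when b > 0 (two components meet), and some zero does not
    admit two exactly when a + b = 2 (a line is a component). Thus an
    isomorphism determines whether b > 0 and whether a + b = 2
    ([isomorphic_exponents]), which leaves only e3 and e4; these differ because
    a plane is connected and two disjoint planes are not. *)

(** * Topology of the charts *)

Section ChartTopology.
Variable K : numFieldType.

Lemma emb_continuous (c : bool) : continuous (@emb K c).
Proof.
move=> p; apply: (@continuous_comp _ _ _ (existT (fun=> 'rV[K]_3) c)
  (\pi_({eq_quot @glued_equiv K})%qT : charts K -> W3 K)).
  exact: existT_continuous.
exact: pi_continuous.
Qed.

Lemma emb_eq (c : bool) (p q : 'rV[K]_3) :
  emb c p = emb (~~ c) q -> p 0 0 != 0 /\ q = trans p.
Proof.
by move=> /eqmodP; rewrite /= /glued /=; case: c => /= /andP[? /eqP].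
Qed.

Lemma open_coord_neq0 (j : 'I_3) : open [set p : 'rV[K]_3 | p 0 j != 0].
Proof.
have : open ((fun p : 'rV[K]_3 => p 0 j) @^-1` [set x : K | x != 0]).
  apply: open_comp; first by move=> p _; exact: coord_continuous.
  rewrite (_ : [set x : K | x != 0] = ~` [set 0]).
    apply/closed_openC/accessible_closed_set1/hausdorff_accessible.
    exact: norm_hausdorff.
  by apply/seteqP; split => x /eqP.
by [].
Qed.

Lemma open_range_emb (c : bool) : open (range (@emb K c)).
Proof.
apply/sigT_openP => d.
have [->|dc] := eqVneq d c.
  rewrite (_ : _ @^-1` _ = setT); first exact: openT.
  by apply/seteqP; split => // p _; exists p.
have {dc} -> : d = ~~ c by case: d c dc => [] [].
rewrite (_ : _ @^-1` _ = [set p : 'rV[K]_3 | p 0 0 != 0]).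
  exact: open_coord_neq0.
apply/seteqP; split => p /=.
  by move=> [q _ /esym]; rewrite -[c in X in _ = X -> _]negbK => /emb_eq[].
move=> p0; exists (trans p) => //; rewrite -[c in LHS]negbK.
exact: emb_trans.
Qed.

End ChartTopology.

(** * Velocities of curves in a subset of a chart *)

Section Tangent.
Variable K : numFieldType.
Implicit Types (Z : set 'rV[K]_3) (p v : 'rV[K]_3).

(** The curve is indexed by the scalar field, so that over the complex numbers
    it is differentiable in the holomorphic sense, and so is its composite with
    a chart expression of an isomorphism. These vectors form a cone, in general
    not a linear subspace. *)
Definition tangent Z p v := exists c : K^o -> 'rV[K]_3,
  [/\ differentiable c 0, 'd c 0 1 = v, c 0 = p & \forall t \near 0, Z (c t)].

Definition tangent_rank_ge n Z p :=
  exists2 A : 'M[K]_(n, 3), row_free A & forall i, tangent Z p (row i A).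

Lemma tangent_line Z p v : (forall t : K, Z (p + t *: v)) -> tangent Z p v.
Proof.
move=> Zp; pose c := (cst p : K^o -> 'rV[K]_3) + ( *:%R ^~ v : K^o -> 'rV[K]_3).
have dc : is_diff (0 : K^o) c (0 + ( *:%R ^~ v)) by exact: is_diffD.
exists c; split => //.
- by rewrite diff_val /= fctE /= add0r scale1r.
- by rewrite /c fctE /= scale0r addr0.
- by near=> t; exact: Zp.
Unshelve. all: by end_near. Qed.

(** A selection of rows of the identity matrix is row free, with the
    corresponding columns as right inverse. *)
Lemma tangent_rank_coord n (s : 'I_n -> 'I_3) Z p : injective s ->
  (forall i t, Z (p + t *: dd (s i))) -> tangent_rank_ge n Z p.
Proof.
move=> s_inj Zp; exists (rowsub s 1%:M).
  apply/row_freeP; exists (colsub s 1%:M); apply/matrixP => i j.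
  by rewrite mulmx_colsub mulmx1 !mxE (inj_eq s_inj).
by move=> i; rewrite row_rowsub row1; apply: tangent_line => t; exact: Zp.
Qed.

(** The two coordinate directions other than [j] stay in the hyperplane. *)
Lemma tangent_rank_hyperplane Z p (j : 'I_3) :
  (forall q : 'rV[K]_3, q 0 j = 0 -> Z q) -> p 0 j = 0 -> tangent_rank_ge 2 Z p.
Proof.
move=> Zj pj; apply: (@tangent_rank_coord _ (lift j)); first exact: lift_inj.
by move=> i t; apply: Zj; rewrite !mxE pj add0r eq_liftF andbF mulr0.
Qed.

(** This is what bounds the rank from above: along a curve in Z the coordinate
    is locally constant, so its derivative is zero. *)
Lemma tangent_coord0 Z p v (j : 'I_3) :
  tangent Z p v -> (\forall q \near p, Z q -> q 0 j = 0) -> v 0 j = 0.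
Proof.
move=> [c [dc <- cp cZ]] pj.
have dj := @differentiable_coord K 1 3 (c 0) 0 j.
have <- : 'D_1 (fun t : K^o => c t 0 j : K^o) 0 = ('d c 0 1) 0 j.
  rewrite deriveE; last exact: (differentiable_comp dc dj).
  by rewrite (diff_comp dc dj) /= diff_coord3.
rewrite (@near_eq_derive K K^o K^o _ (cst 0)) ?derive_cst //.
rewrite -cp in pj.
have := differentiable_continuous dc pj; rewrite /= !near_simpl => pjc.
by near=> t; apply: (near pjc t) => //; near: t.
Unshelve. all: by end_near. Qed.

Lemma tangent_image (Z Z' : set 'rV[K]_3) (f : 'rV[K]_3 -> 'rV[K]_3) p v :
  differentiable f p -> (\forall q \near p, Z q -> Z' (f q)) ->
  tangent Z p v -> tangent Z' (f p) (v *m jacobian f p).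
Proof.
move=> df fZ [c [dc <- cp cZ]]; rewrite -cp in df fZ *.
exists (f \o c); split => //.
- exact: differentiable_comp.
- by rewrite [LHS](congr1 (@^~ 1) (diff_comp dc df)) mul_rV_lin1.
- have := differentiable_continuous dc fZ; rewrite /= !near_simpl => fZc.
  by near=> t; apply: (near fZc t) => //; near: t.
Unshelve. all: by end_near. Qed.

Lemma tangent_rank_image n (Z Z' : set 'rV[K]_3) (f : 'rV[K]_3 -> 'rV[K]_3) p :
  differentiable f p -> row_free (jacobian f p) ->
  (\forall q \near p, Z q -> Z' (f q)) ->
  tangent_rank_ge n Z p -> tangent_rank_ge n Z' (f p).
Proof.
move=> df Jf fZ [A Af AZ]; exists (A *m jacobian f p).
  by rewrite /row_free mxrankMfree.
by move=> i; rewrite row_mul; exact: tangent_image fZ _.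
Qed.

End Tangent.

(** * Invariants of the zero set under Poisson isomorphisms *)

Section Invariance.
Variables (K : numFieldType) (phi psi : W3 K -> W3 K).
Hypothesis phiK : cancel phi psi.
Hypotheses (holo_phi : holomorphic phi) (holo_psi : holomorphic psi).

Lemma near_range_emb (a b : bool) p : range (emb b) (phi (emb a p)) ->
  \forall q \near p, range (emb b) (phi (emb a q)).
Proof.
move=> rp; have := open_nbhs_nbhs (conj (@open_range_emb K b) rp).
have [cphi _] := holo_phi.
have : {for p, continuous (phi \o emb a)}.
  by apply: continuous_comp; [exact: emb_continuous|exact: cphi].
by apply.
Qed.

(** The chain rule applied to the two chart expressions, whose composite is the
    identity near p only: elsewhere phi may leave the chart b. *)
Lemma jacobian_inverse (a b : bool) p p' : phi (emb a p) = emb b p' ->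
  jacobian (Defs.coord b \o phi \o emb a) p *m
    jacobian (Defs.coord a \o psi \o emb b) p' = 1%:M.
Proof.
move=> pp'.
set f := Defs.coord b \o _ \o _; set g := Defs.coord a \o _ \o _.
have fp : f p = p' by rewrite /f /= pp' embK.
have rp : range (emb b) (phi (emb a p)) by exists p'.
have rp' : range (emb a) (psi (emb b p')) by exists p => //; rewrite -pp' phiK.
have df : differentiable f p by apply: holo_phi.2.
have dg : differentiable g (f p) by rewrite fp; apply: holo_psi.2.
apply/row_matrixP => i; rewrite row_mul !rowE mulmx1.
rewrite -[p' in X in _ *m X]fp !mul_rV_lin1 /=.
rewrite -[LHS]/(('d g (f p) \o 'd f p) _) -diff_comp // -deriveE; last first.
  exact: differentiable_comp.
rewrite (near_eq_derive (g := id)) ?derive_id //.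
have := near_range_emb rp; apply: filterS => q /coordK rq.
by rewrite /g /f /= rq phiK embK.
Qed.

End Invariance.

Section Zeros.
Variable K : numFieldType.
Implicit Types pi : poisson K.

Definition zeros pi (c : bool) : set 'rV[K]_3 := [set p | pi c p = 0].

Definition zero_locus pi : set (W3 K) :=
  [set w | exists c p, w = emb c p /\ zeros pi c p].

Definition has_tangent_rank pi n :=
  exists c p, zeros pi c p /\ tangent_rank_ge n (zeros pi c) p.

Definition lacks_tangent_rank pi n :=
  exists c p, zeros pi c p /\ ~ tangent_rank_ge n (zeros pi c) p.

(** From pi' = J^T pi J one gets L^T pi' L = pi, where L inverts J on the
    right. *)
Lemma pushes_inverse (phi psi : W3 K -> W3 K) pi pi' :
  cancel phi psi -> cancel psi phi -> holomorphic phi -> holomorphic psi ->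
  pushes phi pi pi' -> pushes psi pi' pi.
Proof.
move=> phiK psiK hphi hpsi push b a p' [p _ pp'] /=.
have qq : phi (emb a p) = emb b p' by rewrite pp' psiK.
have J1 := jacobian_inverse phiK hphi hpsi qq.
have := push a b p; rewrite qq => /(_ (ex_intro2 _ _ p' I erefl)) /=.
rewrite qq embK -pp' embK => ->.
set J := jacobian _ p in J1 *; set L := jacobian _ p' in J1 *.
have T1 : L^T *m J^T = 1%:M by rewrite -trmx_mul J1 trmx1.
by rewrite !mulmxA T1 mul1mx -mulmxA J1 mulmx1.
Qed.

Lemma poisson_isomorphic_sym pi pi' :
  poisson_isomorphic pi pi' -> poisson_isomorphic pi' pi.
Proof.
move=> [phi [psi [phiK psiK hphi hpsi push]]]; exists psi, phi; split=> //.
exact: pushes_inverse push.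
Qed.

Lemma pushes_zeros (phi : W3 K -> W3 K) pi pi' (a b : bool) p :
  pushes phi pi pi' -> range (emb b) (phi (emb a p)) -> zeros pi a p ->
  zeros pi' b (Defs.coord b (phi (emb a p))).
Proof.
move=> push rp; rewrite /zeros /= => p0.
by have /= -> := push _ _ _ rp; rewrite p0 mulmx0 mul0mx.
Qed.

Lemma tangent_rank_pushes n (phi psi : W3 K -> W3 K) pi pi' (a b : bool) p p' :
  cancel phi psi -> holomorphic phi -> holomorphic psi ->
  pushes phi pi pi' -> phi (emb a p) = emb b p' ->
  tangent_rank_ge n (zeros pi a) p -> tangent_rank_ge n (zeros pi' b) p'.
Proof.
move=> phiK hphi hpsi push pp'.
have rp : range (emb b) (phi (emb a p)) by exists p'.
pose f := Defs.coord b \o phi \o emb a.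
have <- : f p = p' by rewrite /f /= pp' embK.
apply: tangent_rank_image; first exact: hphi.2.
  by apply/row_freeP; eexists; exact: jacobian_inverse pp'.
have := near_range_emb hphi rp; apply: filterS => q rq.
exact: pushes_zeros.
Qed.

Lemma isomorphic_tangent_rank pi pi' c p : poisson_isomorphic pi pi' ->
  zeros pi c p -> exists c' p', zeros pi' c' p' /\
    forall n, tangent_rank_ge n (zeros pi c) p <->
              tangent_rank_ge n (zeros pi' c') p'.
Proof.
move=> [phi [psi [phiK psiK hphi hpsi push]]] zp.
have [c' [p' pp']] := emb_cover (phi (emb c p)).
exists c', p'; split=> [|n].
  have := pushes_zeros push (ex_intro2 _ _ p' I (esym pp')) zp.
  by rewrite pp' embK.
split; first exact: tangent_rank_pushes pp'.
apply: (tangent_rank_pushes psiK) => //.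
  exact: pushes_inverse push.
by rewrite -pp' phiK.
Qed.

Lemma isomorphic_has_tangent_rank pi pi' n : poisson_isomorphic pi pi' ->
  has_tangent_rank pi n -> has_tangent_rank pi' n.
Proof.
move=> iso [c [p [zp rp]]].
have [c' [p' [zp' rpp']]] := isomorphic_tangent_rank iso zp.
by exists c', p'; split=> //; apply/rpp'.
Qed.

Lemma isomorphic_lacks_tangent_rank pi pi' n : poisson_isomorphic pi pi' ->
  lacks_tangent_rank pi n -> lacks_tangent_rank pi' n.
Proof.
move=> iso [c [p [zp rp]]].
have [c' [p' [zp' rpp']]] := isomorphic_tangent_rank iso zp.
by exists c', p'; split=> // /rpp'.
Qed.

Lemma isomorphic_connected pi pi' : poisson_isomorphic pi pi' ->
  connected (zero_locus pi) -> connected (zero_locus pi').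
Proof.
move=> [phi [psi [phiK psiK hphi hpsi push]]] con.
have zl (chi : W3 K -> W3 K) (rho rho' : poisson K) w : pushes chi rho rho' ->
    zero_locus rho w -> zero_locus rho' (chi w).
  move=> pu [c [p [-> zp]]]; have [c' [p' pp']] := emb_cover (chi (emb c p)).
  exists c', p'; split=> //.
  have := pushes_zeros pu (ex_intro2 _ _ p' I (esym pp')) zp.
  by rewrite pp' embK.
have <- : phi @` zero_locus pi = zero_locus pi'.
  apply/seteqP; split => [_ [w zw <-]|w zw]; first exact: zl zw.
  exists (psi w); last exact: psiK.
  exact: (zl psi _ _ _ (pushes_inverse phiK psiK hphi hpsi push)).
apply: connected_continuous_connected => //.
exact/continuous_subspaceT/hphi.1.
Qed.

End Zeros.

(** * The zero sets of the monomial structures *)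

Section MonomialZeros.
Variable K : numFieldType.
Implicit Types p : 'rV[K]_3.

Lemma wedge_d2_eq0 (x y : K) :
  (wedge d2 (x *: d0 + y *: d1) == 0) = (x == 0) && (y == 0).
Proof.
apply/eqP/andP => [w0|[/eqP-> /eqP->]].
  have wE j : wedge d2 (x *: d0 + y *: d1) 2%:R j = 0 by rewrite w0 mxE.
  have := wE 0; have := wE 1; rewrite !wedgeE !mxE /=.
  rewrite ?(mulr0, mulr1, mul1r, mul0r, subr0, addr0, add0r) => -> ->.
  by rewrite eqxx.
by rewrite !scale0r addr0 /wedge mulmx0 trmx0 mul0mx subr0.
Qed.

Lemma mono_bivecU_eq0 a b p : (mono_bivec a b chU p == 0) =
  (0 < a)%N && (p 0 0 == 0) || (0 < b)%N && (p 0 2%:R == 0).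
Proof.
have w0 : (wedge d2 d0 == 0 :> 'M[K]_3) = false.
  by have := wedge_d2_eq0 1 0; rewrite scale1r scale0r addr0 oner_eq0.
by rewrite /mono_bivec scaler_eq0 w0 orbF mulf_eq0 !expf_eq0.
Qed.

Lemma mono_bivecV_eq0 a b p : (mono_bivec a b chV p == 0) =
  [|| (a + b < 2)%N && (p 0 0 == 0), (0 < b)%N && (p 0 2%:R == 0)
    | (p 0 0 == 0) && (p 0 1 == 0)].
Proof.
rewrite /mono_bivec scaler_eq0 wedge_d2_eq0 mulf_eq0 !expf_eq0 subn_gt0.
by rewrite oppr_eq0 mulf_eq0 pnatr_eq0 -orbA.
Qed.

Variables a b : nat.
Hypothesis ab : (a + b <= 2)%N.
Let pi := mono_poisson K ab.

Lemma zerosUP p : zeros pi chU p <->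
  (0 < a)%N && (p 0 0 == 0) || (0 < b)%N && (p 0 2%:R == 0).
Proof. by rewrite -mono_bivecU_eq0; split=> /eqP. Qed.

Lemma zerosVP p : zeros pi chV p <->
  [|| (a + b < 2)%N && (p 0 0 == 0), (0 < b)%N && (p 0 2%:R == 0)
    | (p 0 0 == 0) && (p 0 1 == 0)].
Proof. by rewrite -mono_bivecV_eq0; split=> /eqP. Qed.

Lemma zeros_coord0 (c : bool) p : b = 0%N -> zeros pi c p -> p 0 0 = 0.
Proof.
move=> b0; case: c; [move/zerosUP|move/zerosVP]; rewrite b0 /= ?orbF.
  by case/andP => _ /eqP.
by case/orP => /andP[] => [_|] /eqP.
Qed.

(** All three coordinate axes through the origin of V consist of zeros: v2 = 0
    on two of them, and xi = v1 = 0 on the third. *)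
Lemma tangent_rank_ge3 : (0 < b)%N -> has_tangent_rank pi 3.
Proof.
move=> b0; exists chV, 0.
split; first by apply/zerosVP; rewrite !mxE eqxx !orbT.
apply: (@tangent_rank_coord _ _ id) => // i t; apply/zerosVP.
by rewrite add0r !mxE /= b0; case: i => [[|[|[|//]]] hi] /=;
  rewrite ?mulr0 ?eqxx ?orbT.
Qed.

(** By [zeros_coord0] the velocities all have first coordinate 0. *)
Lemma not_tangent_rank_ge3 : b = 0%N -> ~ has_tangent_rank pi 3.
Proof.
move=> b0 [c [p [_ [A]]]]; rewrite row_free_unit => uA tA.
have A0 i : A i 0 = 0.
  have -> : A i 0 = row i A 0 0 by rewrite mxE.
  by apply: (tangent_coord0 (tA i)); near=> q; exact: zeros_coord0.
have := mulVmx uA => /(congr1 (fun M : 'M[K]_3 => M 0 0)).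
rewrite !mxE big1 => [|i _]; last by rewrite A0 mulr0.
by move/esym/eqP; rewrite oner_eq0.
Unshelve. all: by end_near. Qed.

(** When a + b = 2 the factor xi^(2 - (a + b)) on V disappears, so near the
    point xi = v1 = 0, v2 = 1 the zeros form a line. *)
Lemma lacks_tangent_rank2 : (a + b = 2)%N -> lacks_tangent_rank pi 2.
Proof.
move=> ab2; exists chV, d2.
split; first by apply/zerosVP; rewrite !row3E eqxx !orbT.
move=> [A /row_freeP[B AB] tA].
have near_line : \forall q \near (d2 : 'rV[K]_3),
    zeros pi chV q -> (q 0 0 == 0) && (q 0 1 == 0).
  have : nbhs (d2 : 'rV[K]_3) [set q : 'rV[K]_3 | q 0 2%:R != 0].
    apply: open_nbhs_nbhs; split; first exact: open_coord_neq0.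
    by rewrite /= row3E oner_eq0.
  apply: filterS => q /negbTE q2 /zerosVP.
  by rewrite ab2 q2 andbF.
have A0 i : A i 0 = 0.
  have -> : A i 0 = row i A 0 0 by rewrite mxE.
  apply: (tangent_coord0 (tA i)).
  by apply: filterS near_line => q zq /zq /andP[/eqP].
have A1 i : A i 1 = 0.
  have -> : A i 1 = row i A 0 1 by rewrite mxE.
  apply: (tangent_coord0 (tA i)).
  by apply: filterS near_line => q zq /zq /andP[_ /eqP].
have ABE i j : (i == j)%:R = A i 2%:R * B 2%:R j.
  have := congr1 (fun M : 'M[K]_2 => M i j) AB.
  by rewrite !mxE sum3 A0 A1 !mul0r !add0r => ->.
have := ABE 0 1; have := ABE 0 0; have := ABE 1 1 => /= E11 E00 /esym/eqP.
rewrite mulf_eq0 => /orP[] /eqP E.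
  by move/eqP: E00; rewrite E mul0r oner_eq0.
by move/eqP: E11; rewrite E mulr0 oner_eq0.
Qed.

(** When a + b < 2 the line xi = v1 = 0 lies in the hyperplane xi = 0 of
    zeros, so the zero set is a union of coordinate hyperplanes. *)
Lemma not_lacks_tangent_rank2 : (a + b < 2)%N -> ~ lacks_tangent_rank pi 2.
Proof.
move=> ab2 [c [p [zp]]]; apply.
case: c zp => [/zerosUP|/zerosVP] zp.
  case/orP: zp => /andP[n0 /eqP p0]; apply: (tangent_rank_hyperplane _ p0);
    by move=> q q0; apply/zerosUP; rewrite n0 q0 eqxx ?orbT.
case/or3P: zp => /andP[n0 p0].
- apply: (tangent_rank_hyperplane _ (eqP p0)).
  by move=> q q0; apply/zerosVP; rewrite n0 q0 eqxx.
- apply: (tangent_rank_hyperplane _ (eqP p0)).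
  by move=> q q0; apply/zerosVP; rewrite n0 q0 eqxx !orbT.
- apply: (tangent_rank_hyperplane _ (eqP n0)).
  by move=> q q0; apply/zerosVP; rewrite ab2 q0 eqxx.
Qed.

(** Every zero has first coordinate 0, so it lies in only one of the charts
    U, V; these open sets therefore separate the origins of the two charts. *)
Lemma zero_locus_disconnected : b = 0%N -> (0 < a)%N ->
  ~ connected (zero_locus pi).
Proof.
move=> b0 a0 con; set A := zero_locus pi in con *.
have Z0 c : A (emb c 0).
  exists c, 0; split=> //; case: c; [apply/zerosUP|apply/zerosVP];
    by rewrite !mxE eqxx ?a0 ?orbT.
have separate c w : A w -> range (emb c) w -> ~ range (emb (~~ c)) w.
  move=> [d [p [-> zp]]]; have p0 := zeros_coord0 b0 zp.
  have other e : range (emb (~~ e)) (emb d p) -> d != e.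
    move=> [q _ /esym eq]; apply/eqP => de.
    by move: eq; rewrite de => /emb_eq[]; rewrite p0 eqxx.
  move=> rc /other dc; move: rc; rewrite -[c in range (emb c)]negbK => /other.
  by move: dc; case: (d); case: (c).
suff AU : A `&` range (emb chU) = A.
  have [_ [q _ q0]] : (A `&` range (emb chU)) (emb chV 0).
    by rewrite AU; exact: Z0.
  by have [] := emb_eq (esym q0 : emb chV 0 = emb (~~ chV) q); rewrite mxE eqxx.
apply: con.
- by exists (emb chU 0); split; [exact: Z0|exists 0].
- by exists (range (emb chU)) => //; exact: open_range_emb.
- exists (~` range (emb chV)); first exact/open_closedC/open_range_emb.
  apply/seteqP; split=> w [Aw rw]; split=> //; first exact: (separate chU).
  have [d [p [wp _]]] := Aw; case: d wp => wp; first by exists p.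
  by case: rw; exists p.
Qed.

End MonomialZeros.

(** * Connectedness of the zero set of e3 *)

Section Connectedness.
Variable R : realType.
(* The cast selects the topology that W3 gets from the numFieldType structure. *)
Local Notation C := (R[i] : numFieldType).

Lemma real_complex_continuous :
  continuous ((fun s => real_complex R s) : R -> C).
Proof.
move=> s; apply/cvgrPdist_lt => e.
case: e => er ei; rewrite ltcE /= => /andP[/eqP -> e0].
near=> t.
rewrite -rmorphB /= normc_def /= expr0n addr0 sqrtr_sqr ltcR.
by near: t; apply: cvgr_dist_lt.
Unshelve. all: by end_near. Qed.

Lemma connected_star (A : set 'rV[C]_3) :
  (forall (s : R) v, A v -> A (real_complex R s *: v)) -> connected A.
Proof.
move=> star.
pose line v := (fun s : R => real_complex R s *: v : 'rV[C]_3) @` `[0, 1].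
have -> : A = \bigcup_(v in A) line v.
  apply/seteqP; split => [v Av|_ [v Av [s _ <-]]]; last exact: star.
  exists v => //; exists 1; first by rewrite /= in_itv /= lexx ler01.
  by rewrite rmorph1 scale1r.
apply: bigcup_connected => [|v _].
  exists 0 => v _; exists 0; first by rewrite /= in_itv /= lexx ler01.
  by rewrite rmorph0 scale0r.
apply: connected_continuous_connected; first exact: segment_connected.
apply: continuous_subspaceT => s.
apply: (@continuous_comp _ C _ (fun s : R => real_complex R s) ( *:%R ^~ v)).
  exact: real_complex_continuous.
exact: scalel_continuous.
Qed.

Lemma zero_locus_connected : connected (zero_locus (e3 C)).
Proof.
have -> : zero_locus (e3 C) = @emb C chV @` [set p : 'rV[C]_3 | p 0 0 = 0].
  apply/seteqP; split=> [w [[] [p [-> /= zp]]]|_ [p p0 <-]].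
  - by move/zerosUP: zp.
  - by exists p => //; exact: zeros_coord0 zp.
  - by exists chV, p; split=> //; apply/zerosVP; rewrite p0 eqxx.
apply: connected_continuous_connected.
  by apply: connected_star => s v /= v0; rewrite mxE v0 mulr0.
exact/continuous_subspaceT/emb_continuous.
Qed.

End Connectedness.

(** * Comparison of the five structures *)

Lemma isomorphic_exponents (K : numFieldType) (a b a' b' : nat)
    (ab : (a + b <= 2)%N) (ab' : (a' + b' <= 2)%N) :
  poisson_isomorphic (mono_poisson K ab) (mono_poisson K ab') ->
  (0 < b)%N = (0 < b')%N /\ (a + b == 2)%N = (a' + b' == 2)%N.
Proof.
have one_way c d c' d' (cd : (c + d <= 2)%N) (cd' : (c' + d' <= 2)%N) :
    poisson_isomorphic (mono_poisson K cd) (mono_poisson K cd') ->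
    ((0 < d)%N ==> (0 < d')%N) && ((c + d == 2)%N ==> (c' + d' == 2)%N).
  move=> iso; apply/andP; split; apply/implyP => h; apply: contraT => h'.
    case: (@not_tangent_rank_ge3 K _ _ cd'); first by case: (d') h'.
    exact/(isomorphic_has_tangent_rank iso)/tangent_rank_ge3.
  case: (@not_lacks_tangent_rank2 K _ _ cd'); first by rewrite ltn_neqAle h'.
  exact/(isomorphic_lacks_tangent_rank iso)/lacks_tangent_rank2/eqP.
move=> iso; move: (one_way _ _ _ _ _ _ iso).
move: (one_way _ _ _ _ _ _ (poisson_isomorphic_sym iso)).
by case: (0 < b)%N; case: (0 < b')%N; case: (_ == _); case: (_ == _).
Qed.

(** The pairs (0 < b, a + b = 2) of e3, e4, e5, e10, e11 differ, except for
    e3 and e4. *)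
Theorem lemma5p8 (R : realType) (i j : 'I_5) :
  let e := [tuple e3 R[i]; e4 R[i]; e5 R[i]; e10 R[i]; e11 R[i]] in
  i != j -> ~ poisson_isomorphic (tnth e i) (tnth e j).
Proof.
have e34 : ~ poisson_isomorphic (e3 R[i]) (e4 R[i]).
  move=> /isomorphic_connected /(_ (@zero_locus_connected R)).
  exact: zero_locus_disconnected.
move=> e; rewrite !(tnth_nth (e3 R[i])) {}/e -val_eqE.
case: i j => [i i5] [j j5] /= ij.
case: i i5 ij => [|[|[|[|[|i]]]]] i5 ij; last (by exfalso);
  (case: j j5 ij => [|[|[|[|[|j]]]]] j5 ij; last by exfalso);
  try (by exfalso);
  try (by move=> /isomorphic_exponents[eb eab];
    first [discriminate eb | discriminate eab]).
- exact: e34.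
- by move=> /poisson_isomorphic_sym.
Qed.
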